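(* Let $R$ be a commutative ring with unit, $P$ a poset and $\bar p$ a perversity on $P$. The (contravariant) functors $\langle-\rangle_{\bar p}\colon\mathbf M_{dg}\to\mathrm{Sset}_P$ and $\widetilde N^*_{\bar p}(-)\colon\mathrm{Sset}_P\to\mathbf M_{dg}$ are adjoint: for any $\Psi_L\in\mathrm{Sset}_P$ and $M\in\mathbf M_{dg}$, there are (natural, mutually inverse) bijections $$\mathrm{Hom}_{\mathrm{Sset}_P}(\Psi_L,\langle M\rangle_{\bar p})\;\cong\;\mathrm{Hom}_{\mathbf M_{dg}}(M,\widetilde N^*_{\bar p}(\Psi_L)).$$
   Context: $\mathbf M_{dg}$ is the category of non-negatively graded cochain complexes of $R$-modules (differential of degree $+1$). **Simplicial sets over $P$.** $N(P)$ is the nerve of $P$. An object of $\mathrm{Sset}_P$ is a simplicial map $\Psi_L\colon L\to N(P)$; morphisms are simplicial maps over $N(P)$. Equivalently it is a presheaf on the category $\Delta[P]$ of simplices of $N(P)$ (objects: simplicial maps $\sigma\colon\Delta[k]\to N(P)$; morphisms: simplicial maps over $N(P)$). **Perversities.** A perversity on $P$ is a map $\bar p\colon P\to\mathbb Z\cup\{\pm\infty\}$ equal to $0$ on maximal elements. **Blown-up cochains.** $N^*(-)$ denotes normalized simplicial cochains with coefficients in $R$. A simplex $\sigma$ of $N(P)$ is written $s_0^{[q_0]}\prec\dots\prec s_\ell^{[q_\ell]}$ ($s_i$ repeated $q_i+1$ times, $q_i\ge 0$), giving $\Delta[m]=\Delta[q_0]*\dots*\Delta[q_\ell]$; it is regular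 if $s_\ell$ is maximal in $P$. Let $c\Delta[q]$ be the cone on $\Delta[q]$ with apex $v$ as last vertex, $c\emptyset=\{v\}$. For regular $\sigma$, $\widetilde N^*(\sigma)=N^*(c\Delta[q_0])\otimes\dots\otimes N^*(c\Delta[q_{\ell-1}])\otimes N^*(\Delta[q_\ell])$. It has the basis $\mathbf 1_{(F,\varepsilon)}=\mathbf 1_{(F_0,\varepsilon_0)}\otimes\dots\otimes\mathbf 1_{(F_{\ell-1},\varepsilon_{\ell-1})}\otimes\mathbf 1_{F_\ell}$, where for $i<\ell$, $(F_i,0)$ is a non-empty face $F_i$ of $\Delta[q_i]$, $(F_i,1)$ is the cone $cF_i$ with $F_i$ a possibly empty face, and $F_\ell$ is a face of $\Delta[q_\ell]$. For $s\in P$ the perverse degree $\|\mathbf 1_{(F,\varepsilon)}\|_s$ is $\dim\big((F_{i+1},\varepsilon_{i+1})\times\dots\times F_\ell\big)$ if $s=s_i$ with $i<\ell$ and $\varepsilon_i=0$; it is $0$ if $s=s_\ell$; it is $-\infty$ otherwise. For a linear combination with non-zero coefficients take the maximum; $\|0\|_s=-\infty$. A cochain $\omega$ is $\bar p$-allowable if $\|\omega\|_s\le\bar p(s)$ for all $s$; $\widetilde N^*_{\bar p}(\sigma)$ is the complex of $\omega$ such that $\omega$ and $\delta\omega$ are $\bar p$-allowable. Put $\widetilde N_{\bar p}^*(\sigma)=0$ for non-regular $\sigma$. For a morphism $\alpha\colon\sigma\to\tau$ of regular simplices over $N(P)$, $\alpha^*\colon\widetilde N^*(\tau)\to\widetilde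 N^*(\sigma)$ is the tensor product of the restrictions along the (coned) maps between the blocks over the same element of $P$, and, for a block of $\tau$ over an element not occurring in $\sigma$, of the restriction $N^*(c\Delta[q])\to N^*(\{v\})=R$; this preserves $\widetilde N^*_{\bar p}$, so $\sigma\mapsto\widetilde N^k_{\bar p}(\sigma)$ is a presheaf on $\Delta[P]$. **The two functors.** $\widetilde N^k_{\bar p}(\Psi_L)=\mathrm{Hom}_{\mathrm{Sset}_P}(\Psi_L,\widetilde N^k_{\bar p}(\bullet))$ with the induced differential, and $\langle M\rangle_{\bar p}$ is the presheaf $\sigma\mapsto\mathrm{Hom}_{\mathbf M_{dg}}(M,\widetilde N^*_{\bar p}(\sigma))$ on $\Delta[P]$. *)

(* Defs.v *)
From HB Require Import structures.
From mathcomp Require Import all_boot all_order all_algebra.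
From mathcomp Require Import boolp constructive_ereal.

Set Implicit Arguments.
Unset Strict Implicit.
Unset Printing Implicit Defensive.

Import Order.TTheory GRing.Theory Num.Theory.
Local Open Scope ring_scope.

Record category := Category {
  ob :> Type;
  mor : ob -> ob -> Type;
  idm : forall X, mor X X;
  cmp : forall X Y Z, mor Y Z -> mor X Y -> mor X Z;
  cmpA : forall X Y Z T (h : mor Z T) (g : mor Y Z) (f : mor X Y),
    cmp h (cmp g f) = cmp (cmp h g) f;
  cmp1f : forall X Y (f : mor X Y), cmp (idm Y) f = f;
  cmpf1 : forall X Y (f : mor X Y), cmp f (idm X) = f }.

Arguments mor {c} X Y.
Arguments idm {c} X.
Arguments cmp {c X Y Z} g f.

Record contravariant (C D : category) := Contravariant {
  fob :> C -> D;
  fmap : forall X Y : C, mor X Y -> mor (fob Y) (fob X);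
  fmap1 : forall X, fmap (idm X) = idm (fob X);
  fmap_cmp : forall X Y Z (g : mor Y Z) (f : mor X Y),
    fmap (cmp g f) = cmp (fmap f) (fmap g) }.

Arguments fmap {C D} F {X Y} f : rename.

Lemma linear_eq (R : pzRingType) (U V : lmodType R) (f g : {linear U -> V}) :
  f =1 g -> f = g.
Proof.
case: f g => [f [[fa] [fs]]] [g [[ga] [gs]]] /= fg.
have {fg} E : f = g by apply/funext.
by subst g; congr (GRing.Linear.Pack (GRing.Linear.Class _ _));
  congr (_ _); exact: Prop_irrelevance.
Qed.

Lemma omorphism_eq d d' (T : porderType d) (T' : porderType d')
  (f g : {omorphism T -> T'}) : f =1 g -> f = g.
Proof.
case: f g => [f [[fm]]] [g [[gm]]] /= fg.
have {fg} E : f = g by apply/funext.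
by subst g; congr (Order.OrderMorphism.Pack (Order.OrderMorphism.Class _));
  congr (_ _); exact: Prop_irrelevance.
Qed.

Section CochainComplexes.
Variable R : comPzRingType.

Record cochain_complex := CochainComplex {
  cx_mod :> nat -> lmodType R;
  cx_diff : forall k, {linear cx_mod k -> cx_mod k.+1};
  cx_diffK : forall k (x : cx_mod k), cx_diff k.+1 (cx_diff k x) = 0 }.

Record cochain_map (M N : cochain_complex) := CochainMap {
  cx_map :> forall k, {linear M k -> N k};
  cx_mapE : forall k (x : M k),
    cx_map k.+1 (cx_diff M k x) = cx_diff N k (cx_map k x) }.

Lemma cochain_map_eq M N (f g : cochain_map M N) :
  (forall k x, f k x = g k x) -> f = g.
Proof.
case: f g => [f fE] [g gE] /= fg.
have E : f = g by apply/functional_extensionality_dep => k; apply/linear_eq/fg.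
by subst g; congr CochainMap; exact: Prop_irrelevance.
Qed.

Definition cochain_id M : cochain_map M M :=
  @CochainMap M M (fun k => idfun) (fun k x => erefl).

Lemma cochain_comp_subproof M N K (g : cochain_map N K) (f : cochain_map M N)
  k (x : M k) :
  (g k.+1 \o f k.+1) (cx_diff M k x) = cx_diff K k ((g k \o f k) x).
Proof. by rewrite /= !cx_mapE. Qed.

Definition cochain_comp M N K (g : cochain_map N K) (f : cochain_map M N) :
    cochain_map M K :=
  @CochainMap M K (fun k => g k \o f k) (cochain_comp_subproof g f).

Definition Mdg : category.
Proof.
refine (@Category cochain_complex cochain_map cochain_id cochain_comp _ _ _);
  by move=> *; apply: cochain_map_eq.
Defined.

End CochainComplexes.

Section SimplicialSets.

Record sset := SSet {
  sx :> nat -> Type;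
  sact : forall m n, {omorphism 'I_m.+1 -> 'I_n.+1} -> sx n -> sx m;
  sact1 : forall n (x : sx n), sact idfun x = x;
  sactM : forall l m n (a : {omorphism 'I_l.+1 -> 'I_m.+1})
      (b : {omorphism 'I_m.+1 -> 'I_n.+1}) (x : sx n),
    sact (b \o a) x = sact a (sact b x) }.

Record smap (K L : sset) := SMap {
  sfun :> forall n, K n -> L n;
  sfunE : forall m n (a : {omorphism 'I_m.+1 -> 'I_n.+1}) (x : K n),
    sfun (sact a x) = sact a (sfun x) }.

Lemma smap_eq K L (f g : smap K L) : (forall n x, f n x = g n x) -> f = g.
Proof.
case: f g => [f fE] [g gE] /= fg.
have E : f = g by do 2!apply/functional_extensionality_dep => ?; exact: fg.
by subst g; congr SMap; exact: Prop_irrelevance.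
Qed.

Definition smap_id K : smap K K := @SMap K K (fun n x => x) (fun m n a x => erefl).

Lemma smap_comp_subproof K L J (g : smap L J) (f : smap K L) m n
  (a : {omorphism 'I_m.+1 -> 'I_n.+1}) (x : K n) :
  g m (f m (sact a x)) = sact a (g n (f n x)).
Proof. by rewrite !sfunE. Qed.

Definition smap_comp K L J (g : smap L J) (f : smap K L) : smap K J :=
  @SMap K J (fun n x => g n (f n x)) (smap_comp_subproof g f).

End SimplicialSets.

Section SimplicialSetsOver.
Context {d : Order.disp_t}.
Variable P : porderType d.

Definition nerve : sset.
Proof.
refine (@SSet (fun n => {omorphism 'I_n.+1 -> P})
  (fun m n (a : {omorphism 'I_m.+1 -> 'I_n.+1}) (s : {omorphism 'I_n.+1 -> P}) =>
     s \o a : {omorphism 'I_m.+1 -> P}) _ _);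
  by move=> *; apply: omorphism_eq.
Defined.

Record sset_over := SSetOver {
  sset_tot :> sset;
  sset_proj : smap sset_tot nerve }.

Record smap_over (K L : sset_over) := SMapOver {
  smap_tot :> smap K L;
  smap_totE : forall n (x : K n), sset_proj L n (smap_tot n x) = sset_proj K n x }.

Lemma smap_over_eq K L (f g : smap_over K L) :
  (forall n x, f n x = g n x) -> f = g.
Proof.
case: f g => [f fE] [g gE] /= /smap_eq fg.
by subst g; congr SMapOver; exact: Prop_irrelevance.
Qed.

Definition smap_over_id K : smap_over K K :=
  @SMapOver K K (smap_id K) (fun n x => erefl).

Lemma smap_over_comp_subproof K L J (g : smap_over L J) (f : smap_over K L)
  n (x : K n) : sset_proj J n (smap_comp g f n x) = sset_proj K n x.
Proof. by rewrite /= !smap_totE. Qed.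

Definition smap_over_comp K L J (g : smap_over L J) (f : smap_over K L) :
    smap_over K J :=
  SMapOver (smap_over_comp_subproof g f).

Definition SsetP : category.
Proof.
refine (@Category sset_over smap_over smap_over_id smap_over_comp _ _ _);
  by move=> *; apply: smap_over_eq.
Defined.

(* By the Yoneda lemma a simplicial map Delta[n] -> N(P) is an n-simplex of
   N(P), and a map Delta[m] -> Delta[n] over N(P) is a monotone map [m] -> [n]
   commuting with the labels in P. *)
Record over_map m n (s : nerve m) (t : nerve n) := OverMap {
  over_fun :> {omorphism 'I_m.+1 -> 'I_n.+1};
  over_funE : forall i, t (over_fun i) = s i }.

Lemma over_map_eq m n (s : nerve m) (t : nerve n) (a b : over_map s t) :
  a =1 b -> a = b.
Proof.
case: a b => [a aE] [b bE] /= /omorphism_eq ab.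
by subst b; congr OverMap; exact: Prop_irrelevance.
Qed.

Definition over_id m (s : nerve m) : over_map s s :=
  @OverMap m m s s idfun (fun i => erefl).

Lemma over_comp_subproof l m n (r : nerve l) (s : nerve m) (t : nerve n)
  (b : over_map s t) (a : over_map r s) i : t ((b \o a) i) = r i.
Proof. by rewrite /= !over_funE. Qed.

Definition over_comp l m n (r : nerve l) (s : nerve m) (t : nerve n)
    (b : over_map s t) (a : over_map r s) : over_map r t :=
  @OverMap l n r t (b \o a) (over_comp_subproof b a).

Record presheaf := Presheaf {
  psh_ob :> forall m, nerve m -> Type;
  psh_res : forall m n (s : nerve m) (t : nerve n),
    over_map s t -> psh_ob t -> psh_ob s;
  psh_res1 : forall m (s : nerve m) (x : psh_ob s), psh_res (over_id s) x = x;
  psh_resM : forall l m n (r : nerve l) (s : nerve m) (t : nerve n)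
      (b : over_map s t) (a : over_map r s) (x : psh_ob t),
    psh_res (over_comp b a) x = psh_res a (psh_res b x) }.

Record presheaf_map (F G : presheaf) := PresheafMap {
  psh_map :> forall m (s : nerve m), F m s -> G m s;
  psh_mapE : forall m n (s : nerve m) (t : nerve n) (a : over_map s t) (x : F n t),
    psh_map (psh_res a x) = psh_res a (psh_map x) }.

(* The simplicial set over N(P) corresponding to a presheaf F on the category of
   simplices of N(P): its fibre over the simplex s is F s. *)
Section Total.
Variable F : presheaf.

Definition total_sx n : Type := {s : nerve n & F n s}.

Definition over_pull m n (a : {omorphism 'I_m.+1 -> 'I_n.+1}) (t : nerve n) :
    over_map (sact a t) t :=
  @OverMap m n (sact a t) t a (fun i => erefl).

Definition total_act m n (a : {omorphism 'I_m.+1 -> 'I_n.+1}) (y : total_sx n) :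
    total_sx m :=
  existT (fun s => F m s) (sact a (projT1 y)) (psh_res (over_pull a (projT1 y)) (projT2 y)).

Lemma existT_res m (s s' : nerve m) (a : over_map s s') (x : F m s') :
  a =1 id -> existT (fun s => F m s) s (psh_res a x) = existT (fun s => F m s) s' x.
Proof.
move=> aid; have E : s = s'.
  by apply: omorphism_eq => i; rewrite -(over_funE a) aid.
subst s'; congr existT; rewrite -[RHS]psh_res1; congr psh_res.
exact: over_map_eq.
Qed.

Lemma total_act1 n (y : total_sx n) : total_act idfun y = y.
Proof. by case: y => s x; exact: existT_res. Qed.

Lemma total_actM l m n (a : {omorphism 'I_l.+1 -> 'I_m.+1})
    (b : {omorphism 'I_m.+1 -> 'I_n.+1}) (y : total_sx n) :
  total_act (b \o a) y = total_act a (total_act b y).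
Proof.
case: y => t x; rewrite /total_act /= -psh_resM.
have := existT_res (s := sact (b \o a) t) (s' := sact a (sact b t)).
move=> /(_ (@OverMap _ _ (sact (b \o a) t) (sact a (sact b t)) idfun (fun=> erefl))).
move=> <- //; rewrite -psh_resM; congr existT; congr psh_res.
exact: over_map_eq.
Qed.

Definition total_sset : sset := SSet total_act1 total_actM.

Definition total_space : sset_over :=
  @SSetOver total_sset
    (@SMap total_sset nerve (fun n y => projT1 y) (fun m n a x => erefl)).

End Total.

Section TotalMap.
Variables (F G : presheaf) (f : presheaf_map F G).

Definition total_map_fun n (y : total_space F n) : total_space G n :=
  existT (fun s => G n s) (projT1 y) (f n (projT1 y) (projT2 y)).

Lemma total_map_funE m n (a : {omorphism 'I_m.+1 -> 'I_n.+1}) (y : total_space F n) :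
  total_map_fun (sact a y) = sact a (total_map_fun y).
Proof. by case: y => s x; congr existT; exact: psh_mapE. Qed.

Definition total_map : smap_over (total_space F) (total_space G) :=
  @SMapOver (total_space F) (total_space G) (SMap total_map_funE) (fun n y => erefl).

End TotalMap.

End SimplicialSetsOver.

Section Values.
Context {d : Order.disp_t} {P : porderType d}.
Variables (L : sset_over P) (F : presheaf P).

Definition over_eq m (s s' : nerve P m) (e : s = s') : over_map s s' :=
  @OverMap d P m m s s' idfun (fun i => congr1 (fun r : nerve P m => r i) (esym e)).

Definition over_proj m n (a : {omorphism 'I_m.+1 -> 'I_n.+1}) (x : L n) :
    over_map (sset_proj L m (sact a x)) (sset_proj L n x) :=
  @OverMap d P m n (sset_proj L m (sact a x)) (sset_proj L n x) a
    (fun i => congr1 (fun r : nerve P m => r i) (esym (sfunE (sset_proj L) a x))).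

(* The component in F (Psi_L x) of the value at x of a map over N(P). *)
Definition value (h : smap_over L (total_space F)) n (x : L n) : F n (sset_proj L n x) :=
  psh_res (over_eq (esym (smap_totE h x))) (projT2 (h n x)).

Lemma valueE (h : smap_over L (total_space F)) n (x : L n) :
  h n x = existT (fun s => F n s) (sset_proj L n x) (value h x).
Proof.
rewrite /value; move: (esym _); case: (h n x) => s y /= e.
by rewrite existT_res.
Qed.

Lemma value_eq (h g : smap_over L (total_space F)) :
  (forall n (x : L n), value h x = value g x) -> h = g.
Proof. by move=> hg; apply: smap_over_eq => n x; rewrite !valueE hg. Qed.

Lemma psh_res_ext m n (s : nerve P m) (t : nerve P n) (a b : over_map s t)
  (y : F n t) : a =1 b -> psh_res a y = psh_res b y.
Proof. by move=> /over_map_eq ->. Qed.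

Lemma psh_res_id m (s : nerve P m) (a : over_map s s) (y : F m s) :
  a =1 id -> psh_res a y = y.
Proof.
by move=> aid; rewrite -[RHS]psh_res1; apply: psh_res_ext.
Qed.

Lemma existT_value m (s : nerve P m) (y z : F m s) :
  existT (fun s => F m s) s y = existT (fun s => F m s) s z -> y = z.
Proof.
move=> /(congr1 (fun u : total_sx F m =>
  if pselect (projT1 u = s) is left e
  then psh_res (over_eq (esym e)) (projT2 u) else y)) /=.
by case: pselect => // e; rewrite !psh_res_id.
Qed.

Lemma value_act (h : smap_over L (total_space F)) m n
    (a : {omorphism 'I_m.+1 -> 'I_n.+1}) (x : L n) :
  value h (sact a x) = psh_res (over_proj a x) (value h x).
Proof.
apply: existT_value; rewrite -valueE sfunE valueE /= /total_act /=.
set u := psh_res _ _; set v := psh_res _ _.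
have -> : v = psh_res (over_eq (sfunE (sset_proj L) a x)) u.
  by rewrite /u /v -[RHS]psh_resM; apply: psh_res_ext.
by rewrite existT_res.
Qed.

Section OfValues.
Variable w : forall n (x : L n), F n (sset_proj L n x).
Hypothesis wE : forall m n (a : {omorphism 'I_m.+1 -> 'I_n.+1}) (x : L n),
  w (sact a x) = psh_res (over_proj a x) (w x).

Definition of_values_fun n (x : L n) : total_space F n :=
  existT (fun s => F n s) (sset_proj L n x) (w x).

Lemma of_values_funE m n (a : {omorphism 'I_m.+1 -> 'I_n.+1}) (x : L n) :
  of_values_fun (sact a x) = sact a (of_values_fun x).
Proof.
rewrite /of_values_fun wE /= /total_act /=; set v := psh_res (over_pull _ _) _.
rewrite -(existT_res (a := over_eq (sfunE (sset_proj L) a x)) v) //.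
by rewrite /v -psh_resM; congr existT; apply: psh_res_ext.
Qed.

Definition of_values : smap_over L (total_space F) :=
  @SMapOver d P L (total_space F) (SMap of_values_funE) (fun n x => erefl).

Lemma of_valuesE n (x : L n) : value of_values x = w x.
Proof. by rewrite /value psh_res_id. Qed.

End OfValues.
End Values.

Section ModulePresheaves.
Context {d : Order.disp_t} {P : porderType d}.
Variable R : comPzRingType.

Record mod_presheaf := ModPresheaf {
  mpsh_ob : forall m, nerve P m -> lmodType R;
  mpsh_res : forall m n (s : nerve P m) (t : nerve P n),
    over_map s t -> {linear mpsh_ob t -> mpsh_ob s};
  mpsh_res1 : forall m (s : nerve P m) (x : mpsh_ob s), mpsh_res (over_id s) x = x;
  mpsh_resM : forall l m n (r : nerve P l) (s : nerve P m) (t : nerve P n)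
      (b : over_map s t) (a : over_map r s) (x : mpsh_ob t),
    mpsh_res (over_comp b a) x = mpsh_res a (mpsh_res b x) }.

Definition psh_of_mpsh (F : mod_presheaf) : presheaf P :=
  @Presheaf d P (mpsh_ob F) (mpsh_res F) (@mpsh_res1 F) (@mpsh_resM F).

(* The R-module of maps over N(P) from L to (the total space of) F, with the
   operations of the fibres. *)
Definition sections (L : sset_over P) (F : mod_presheaf) : Type :=
  smap_over L (total_space (psh_of_mpsh F)).

Section SectionsModule.
Variables (L : sset_over P) (F : mod_presheaf).
Implicit Types (h g : sections L F) (c : R).

Definition sec_val h n (x : L n) : mpsh_ob F (sset_proj L n x) :=
  value (F := psh_of_mpsh F) h x.

Lemma sec_val_act h m n (a : {omorphism 'I_m.+1 -> 'I_n.+1}) (x : L n) :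
  sec_val h (sact a x) = mpsh_res F (over_proj a x) (sec_val h x).
Proof. exact: (value_act (F := psh_of_mpsh F)). Qed.

Lemma sec_val_eq h g : (forall n (x : L n), sec_val h x = sec_val g x) -> h = g.
Proof. exact: (value_eq (F := psh_of_mpsh F)). Qed.

Fact sec0_subproof m n (a : {omorphism 'I_m.+1 -> 'I_n.+1}) (x : L n) :
  0 = mpsh_res F (over_proj a x) 0.
Proof. by rewrite linear0. Qed.

Fact sec_opp_subproof h m n (a : {omorphism 'I_m.+1 -> 'I_n.+1}) (x : L n) :
  - sec_val h (sact a x) = mpsh_res F (over_proj a x) (- sec_val h x).
Proof. by rewrite linearN sec_val_act. Qed.

Fact sec_add_subproof h g m n (a : {omorphism 'I_m.+1 -> 'I_n.+1}) (x : L n) :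
  sec_val h (sact a x) + sec_val g (sact a x) =
  mpsh_res F (over_proj a x) (sec_val h x + sec_val g x).
Proof. by rewrite linearD !sec_val_act. Qed.

Fact sec_scale_subproof c h m n (a : {omorphism 'I_m.+1 -> 'I_n.+1}) (x : L n) :
  c *: sec_val h (sact a x) = mpsh_res F (over_proj a x) (c *: sec_val h x).
Proof. by rewrite linearZ sec_val_act. Qed.

Definition sec0 : sections L F :=
  of_values (F := psh_of_mpsh F) (w := fun n x => 0) sec0_subproof.
Definition sec_opp h : sections L F :=
  of_values (F := psh_of_mpsh F) (w := fun n x => - sec_val h x) (sec_opp_subproof h).
Definition sec_add h g : sections L F :=
  of_values (F := psh_of_mpsh F) (w := fun n x => sec_val h x + sec_val g x)
    (sec_add_subproof h g).
Definition sec_scale c h : sections L F :=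
  of_values (F := psh_of_mpsh F) (w := fun n x => c *: sec_val h x)
    (sec_scale_subproof c h).

Lemma sec_val0 n (x : L n) : sec_val sec0 x = 0.
Proof. exact: (of_valuesE (F := psh_of_mpsh F)). Qed.
Lemma sec_valN h n (x : L n) : sec_val (sec_opp h) x = - sec_val h x.
Proof. exact: (of_valuesE (F := psh_of_mpsh F)). Qed.
Lemma sec_valD h g n (x : L n) : sec_val (sec_add h g) x = sec_val h x + sec_val g x.
Proof. exact: (of_valuesE (F := psh_of_mpsh F)). Qed.
Lemma sec_valZ c h n (x : L n) : sec_val (sec_scale c h) x = c *: sec_val h x.
Proof. exact: (of_valuesE (F := psh_of_mpsh F)). Qed.

Fact sec_addA : associative sec_add.
Proof. by move=> h g k; apply: sec_val_eq => n x; rewrite !sec_valD addrA. Qed.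
Fact sec_addC : commutative sec_add.
Proof. by move=> h g; apply: sec_val_eq => n x; rewrite !sec_valD addrC. Qed.
Fact sec_add0 : left_id sec0 sec_add.
Proof. by move=> h; apply: sec_val_eq => n x; rewrite sec_valD sec_val0 add0r. Qed.
Fact sec_addN : left_inverse sec0 sec_opp sec_add.
Proof.
by move=> h; apply: sec_val_eq => n x; rewrite sec_valD sec_valN sec_val0 addNr.
Qed.

HB.instance Definition _ := gen_eqMixin (sections L F).
HB.instance Definition _ := gen_choiceMixin (sections L F).
HB.instance Definition _ :=
  GRing.isZmodule.Build (sections L F) sec_addA sec_addC sec_add0 sec_addN.

Fact sec_scaleA c c' h : sec_scale c (sec_scale c' h) = sec_scale (c * c') h.
Proof. by apply: sec_val_eq => n x; rewrite !sec_valZ scalerA. Qed.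
Fact sec_scale1 : left_id 1 sec_scale.
Proof. by move=> h; apply: sec_val_eq => n x; rewrite sec_valZ scale1r. Qed.
Fact sec_scaleDr : right_distributive sec_scale +%R.
Proof.
by move=> c h g; apply: sec_val_eq => n x; rewrite !(sec_valZ, sec_valD) scalerDr.
Qed.
Fact sec_scaleDl h : {morph sec_scale^~ h : c c' / c + c'}.
Proof.
by move=> c c'; apply: sec_val_eq => n x; rewrite !(sec_valZ, sec_valD) scalerDl.
Qed.

HB.instance Definition _ :=
  GRing.Zmodule_isLmodule.Build R (sections L F)
    sec_scaleA sec_scale1 sec_scaleDr sec_scaleDl.

Lemma sec_valP c h g n (x : L n) : sec_val (c *: h + g) x = c *: sec_val h x + sec_val g x.
Proof. by rewrite sec_valD sec_valZ. Qed.

End SectionsModule.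
End ModulePresheaves.

Section BlownUp.
Context {d : Order.disp_t} {P : porderType d}.
Variable R : comPzRingType.

Definition maximal (x : P) : Prop := forall y : P, (x <= y)%O -> y = x.

Definition regular m (s : nerve P m) : Prop := maximal (s ord_max).

(* The set {s_0, ..., s_l} of values of the simplex s = s_0^[q_0] < ... < s_l^[q_l];
   the last one, s_l, is s ord_max. *)
Definition block m (s : nerve P m) : Type := seq_sub (codom s).

HB.instance Definition _ m (s : nerve P m) := Finite.on (block s).
HB.instance Definition _ m (s : nerve P m) := SubType.on (block s).

(* A family (F_b, eps_b)_b, where the face (F_b, eps_b) of the cone on the block b
   is given by its vertices: [Some i] for the vertex i of Delta[m], and [None] for
   the apex of the cone on the block, so that eps_b = 1 iff [None] is a vertex. *)
Definition block_family m (s : nerve P m) := {ffun block s -> {set option 'I_m.+1}}.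

Definition is_face m (s : nerve P m) (T : block_family s) : bool :=
  [forall b : block s, (T b != set0) &&
    [forall x in T b, if x is Some i then s i == val b else val b != s ord_max]].

Definition face m (s : nerve P m) : Type := {T : block_family s | is_face T}.

HB.instance Definition _ m (s : nerve P m) := Finite.on (face s).
HB.instance Definition _ m (s : nerve P m) := SubType.on (face s).

Definition face_dim m (s : nerve P m) (T : block_family s) : nat :=
  (\sum_(b : block s) #|T b|.-1)%N.

(* A tensor product of free modules is free on the products of basis elements:
   a blown-up cochain is given by its coordinates in the basis 1_(F,eps). *)
Definition cochains m (s : nerve P m) : Type := {ffun face s -> R^o}.

HB.instance Definition _ m (s : nerve P m) := GRing.Lmodule.on (cochains s).

(* The coordinates of a cochain, extended by 0 to the families which are not faces
   of the product. *)
Definition coef m (s : nerve P m) (w : cochains s) (T : block_family s) : R :=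
  if insub T is Some F then w F else 0.

(* The order of the vertices of a cone, the apex being the last one. *)
Definition before n (y x : option 'I_n) : bool :=
  match y, x with
  | Some j, Some i => (j < i)%N
  | Some _, None => true
  | None, _ => false
  end.

Definition delete m (s : nerve P m) (T : block_family s) (b : block s)
    (x : option 'I_m.+1) : block_family s :=
  [ffun c => if c == b then T c :\ x else T c].

(* The sign of the tensor product of the simplicial coboundaries
     (delta w)(F) = \sum_x (-1)^(number of vertices of F before x) w(F \ x),
   with the Koszul sign of the tensor factors preceding b. *)
Definition delete_sign m (s : nerve P m) (T : block_family s) (b : block s)
    (x : option 'I_m.+1) : R :=
  (-1) ^+ (\sum_(c : block s | (val c < val b)%O) #|T c|.-1
           + #|[set y in T b | before y x]|).

Definition diff m (s : nerve P m) (w : cochains s) : cochains s :=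
  [ffun F : face s => \sum_(b : block s) \sum_(x in val F b)
     delete_sign (val F) b x * coef w (delete (val F) b x)].

(* The image of a family of faces under the (coned) maps between the blocks over
   the same element of P; over the blocks which do not occur in s it is the
   apex. *)
Definition push m n (s : nerve P m) (t : nerve P n) (a : over_map s t)
    (T : block_family s) : block_family t :=
  [ffun c : block t =>
     if insub (val c) is Some b then [set omap a x | x in T (b : block s)]
     else [set None]].

Definition inj_on m n (s : nerve P m) (t : nerve P n) (a : over_map s t)
    (T : block_family s) : bool :=
  [forall b : block s, dinjectiveb (omap a) (T b)].

(* A normalized cochain vanishes on degenerate simplices, hence the condition
   that a be injective on every factor. *)
Definition restrict m n (s : nerve P m) (t : nerve P n) (a : over_map s t)
    (w : cochains t) : cochains s :=
  [ffun F : face s => if inj_on a (val F) then coef w (push a (val F)) else 0].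

Definition perverse_degree_face m (s : nerve P m) (T : block_family s) (x : P) : \bar int :=
  if x == s ord_max then 0%E
  else if insub x is Some b then
    if None \notin T (b : block s)
    then ((\sum_(c : block s | (val b < val c)%O) #|T c|.-1)%N%:Z)%:E
    else -oo%E
  else -oo%E.

Definition perverse_degree m (s : nerve P m) (w : cochains s) (x : P) : \bar int :=
  \big[maxe/-oo%E]_(F : face s | w F != 0) perverse_degree_face (val F) x.

Record perversity := Perversity {
  perv :> P -> \bar int;
  pervE : forall x, maximal x -> perv x = 0%E }.

Definition allowable (p : perversity) m (s : nerve P m) (w : cochains s) : Prop :=
  forall x : P, (perverse_degree w x <= p x)%E.

Definition homogeneous k m (s : nerve P m) (w : cochains s) : Prop :=
  forall F : face s, w F != 0 -> face_dim (val F) = k.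

(* The graded component of degree k of the complex of the cochains w such that w
   and its coboundary are p-allowable; it is 0 if s is not regular. *)
Definition blowup_pred (p : perversity) m (s : nerve P m) k : {pred cochains s} :=
  fun w => if `[< regular s >]
    then `[< [/\ homogeneous k w, allowable p w & allowable p (diff w)] >]
    else w == 0.

Lemma face_neq0 m (s : nerve P m) (T : block_family s) b : is_face T -> T b != set0.
Proof. by move=> /forallP/(_ b)/andP[]. Qed.

Lemma face_some m (s : nerve P m) (T : block_family s) b i :
  is_face T -> Some i \in T b -> s i = val b.
Proof. by move=> /forallP/(_ b)/andP[_ /forall_inP H] /H /eqP. Qed.

Lemma face_none m (s : nerve P m) (T : block_family s) b :
  is_face T -> None \in T b -> val b != s ord_max.
Proof. by move=> /forallP/(_ b)/andP[_ /forall_inP H] /H. Qed.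

Lemma coef_face m (s : nerve P m) (w : cochains s) (F : face s) :
  coef w (val F) = w F.
Proof. by rewrite /coef valK. Qed.

Lemma coef_nface m (s : nerve P m) (w : cochains s) (T : block_family s) :
  ~~ is_face T -> coef w T = 0.
Proof. by move=> nT; rewrite /coef insubN. Qed.

Lemma coef_empty m (s : nerve P m) (w : cochains s) (T : block_family s) b :
  T b = set0 -> coef w T = 0.
Proof.
move=> Tb; apply: coef_nface; apply/negP => /(face_neq0 b).
by rewrite Tb eqxx.
Qed.

Lemma coefP m (s : nerve P m) (w v : cochains s) (c : R) T :
  coef (c *: w + v) T = c * coef w T + coef v T.
Proof.
rewrite /coef; case: insub => [F|]; last by rewrite mulr0 addr0.
by rewrite !ffunE.
Qed.

Lemma diff_is_linear m (s : nerve P m) : linear (@diff m s).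
Proof.
move=> c w v; apply/ffunP => F; rewrite !ffunE scaler_sumr -big_split /=.
apply: eq_bigr => b _; rewrite scaler_sumr -big_split /=; apply: eq_bigr => x _.
by rewrite coefP mulrDr mulrCA.
Qed.

HB.instance Definition _ m (s : nerve P m) :=
  GRing.isLinear.Build R (cochains s) (cochains s) _ (@diff m s) (@diff_is_linear m s).

Lemma restrict_is_linear m n (s : nerve P m) (t : nerve P n) (a : over_map s t) :
  linear (restrict a).
Proof.
move=> c w v; apply/ffunP => F; rewrite !ffunE.
by case: ifP => _; rewrite ?coefP // scaler0 addr0.
Qed.

HB.instance Definition _ m n (s : nerve P m) (t : nerve P n) (a : over_map s t) :=
  GRing.isLinear.Build R (cochains t) (cochains s) _ (restrict a) (restrict_is_linear a).

Lemma block_total m (s : nerve P m) (b c : block s) :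
  b != c -> (val b < val c)%O || (val c < val b)%O.
Proof.
move=> bc; have : val b != val c by [].
have /codomP[i ->] := valP b; have /codomP[j ->] := valP c.
move=> ij; rewrite !lt_neqAle (eq_sym (s j)) ij /=.
by case/orP: (leq_total i j) => h; apply/orP; [left|right]; apply: omorph_le.
Qed.

Lemma antisym_sum (I : finType) (Q : pred I) (g : I -> I -> R) :
  (forall u v, Q u -> Q v -> u != v -> g u v = - g v u) ->
  \sum_(u | Q u) \sum_(v | Q v && (v != u)) g u v = 0.
Proof.
move=> gN; pose lt (u v : I) := (enum_rank u < enum_rank v)%N.
have -> : \sum_(u | Q u) \sum_(v | Q v && (v != u)) g u v =
  \sum_(u | Q u) \sum_(v | Q v && lt u v) g u v +
  \sum_(u | Q u) \sum_(v | Q v && lt v u) g u v.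
  rewrite -big_split /=; apply: eq_bigr => u Qu.
  rewrite (bigID (lt u)) /=; congr (_ + _); apply: eq_bigl => v.
    rewrite -andbA; congr (_ && _); rewrite /lt.
    by case: eqP => [->|//]; rewrite ltnn.
  rewrite -andbA; congr (_ && _); rewrite /lt -leqNgt (leq_eqVlt (enum_rank v)).
  case: eqP => [->|/eqP vu]; first by rewrite ltnn.
  by rewrite (inj_eq val_inj) (inj_eq enum_rank_inj) (negbTE vu).
rewrite [X in _ + X](exchange_big_dep Q) /=; last by move=> u v _ /andP[].
rewrite -big_split /= big1 // => u Qu; rewrite [X in _ + X](eq_bigl (fun v => Q v && lt u v)).
  rewrite -big_split big1 //= => v /andP[Qv uv]; rewrite gN ?addNr //.
  by apply: contraTneq uv => ->; rewrite /lt ltnn.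
by move=> v; rewrite Qu.
Qed.

Lemma before_irr n (x : option 'I_n) : before x x = false.
Proof. by case: x => //= i; rewrite ltnn. Qed.

Lemma before_anti n (x y : option 'I_n) : before x y -> before y x = false.
Proof. by case: x y => [i|] [j|] //= ij; apply/negbTE; rewrite -leqNgt ltnW. Qed.

Lemma before_trans n : transitive (@before n).
Proof. by move=> [j|] [i|] [k|] //=; apply: ltn_trans. Qed.

Lemma before_total n (x y : option 'I_n) : x != y -> before x y || before y x.
Proof.
case: x y => [i|] [j|] //= ij; case: ltngtP => // /val_inj E.
by rewrite E eqxx in ij.
Qed.

Lemma delete_neq m (s : nerve P m) (T : block_family s) b c x :
  c != b -> delete T b x c = T c.
Proof. by rewrite ffunE => /negbTE ->. Qed.

Lemma delete_eq m (s : nerve P m) (T : block_family s) b x : delete T b x b = T b :\ x.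
Proof. by rewrite ffunE eqxx. Qed.

Lemma deleteC m (s : nerve P m) (T : block_family s) b x c y :
  delete (delete T b x) c y = delete (delete T c y) b x.
Proof.
apply/ffunP => e; rewrite !ffunE.
by case: eqP => [->|_]; case: eqP => // _; rewrite !setDDl setUC.
Qed.

Lemma delete_face m (s : nerve P m) (T : block_family s) b x :
  is_face T -> is_face (delete T b x) = (T b :\ x != set0).
Proof.
move=> fT; apply/idP/idP => [/(face_neq0 b)|Tb]; first by rewrite delete_eq.
apply/forallP => c; rewrite ffunE; case: (c =P b) => [->|_]; last by move/forallP: fT; apply.
rewrite Tb /=; apply/forall_inP => y /setD1P[_ yT].
by have /forallP/(_ b)/andP[_ /forall_inP] := fT; apply.
Qed.

Lemma coef_diff m (s : nerve P m) (w : cochains s) (T : block_family s) :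
  is_face T \/ (exists b, T b = set0) ->
  coef (diff w) T = \sum_b \sum_(x in T b)
     delete_sign T b x * coef w (delete T b x).
Proof.
have [fT _|nfT [//|[b Tb]]] := boolP (is_face T).
  by rewrite -[T]/(val (Sub T fT : face s)) coef_face ffunE.
rewrite (coef_empty _ Tb) big1 // => c _; rewrite big1 // => x xT.
rewrite (@coef_empty _ _ _ _ b) ?mulr0 // ffunE Tb.
by case: eqP => // _; rewrite set0D.
Qed.

Lemma signr_S k : (-1) ^+ k.+1 = - (-1) ^+ k :> R.
Proof. by rewrite exprS mulN1r. Qed.

Lemma set_before_D1 n (A : {set option 'I_n}) x y : before y x || (y == x) ->
  [set z in A :\ x | before z y] = [set z in A | before z y].
Proof.
move=> yx; apply/setP => z; rewrite !inE; case: eqP => //= ->.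
case/orP: yx => [/before_anti ->|/eqP ->]; by rewrite ?before_irr andbF.
Qed.

Lemma card_before_D1 n (A : {set option 'I_n}) x y : x \in A -> before x y ->
  #|[set z in A | before z y]| = #|[set z in A :\ x | before z y]|.+1.
Proof.
move=> xA xy; rewrite (cardsD1 x) !inE xA xy /= add1n; congr _.+1.
by apply: eq_card => z; rewrite !inE andbA.
Qed.

Lemma delete_sign_anti m (s : nerve P m) (T : block_family s) b c x y :
  is_face (delete (delete T b x) c y) ->
  x \in T b -> y \in T c -> (b, x) != (c, y) ->
  delete_sign T b x * delete_sign (delete T b x) c y =
  - (delete_sign T c y * delete_sign (delete T c y) b x).
Proof.
wlog : b c x y / (b == c) && before x y || (val b < val c)%O.
  move=> H f2 xT yT neq.
  have [E|bc] := eqVneq b c.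
    subst c; have xy : x != y by apply: contraNneq neq => ->.
    case/orP: (before_total xy) => h; first by apply: H; rewrite ?h ?eqxx.
    apply/eqP; rewrite eq_sym eqr_oppLR; apply/eqP; apply: H => //.
    - by rewrite h eqxx.
    - by rewrite deleteC.
    - by rewrite eq_sym.
  case/orP: (block_total bc) => h; first by apply: H; rewrite ?h ?orbT.
  apply/eqP; rewrite eq_sym eqr_oppLR; apply/eqP; apply: H => //.
  - by rewrite h orbT.
  - by rewrite deleteC.
  - by rewrite eq_sym.
move=> + f2 xT yT _; rewrite /delete_sign -!exprD.
case/orP => [/andP[/eqP <-]|bc].
  move=> xy.
  have E z : (\sum_(c0 | (val c0 < val b)%O) #|delete T b z c0|.-1 =
         \sum_(c0 | (val c0 < val b)%O) #|T c0|.-1)%N.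
    by apply: eq_bigr => e eb; rewrite delete_neq //; apply: contraTneq eb => ->; rewrite ltxx.
  rewrite !E !delete_eq (@set_before_D1 _ _ y x) ?xy // (card_before_D1 xT xy).
  by rewrite !addnS !addSn signr_S opprK; congr (_ ^+ _); rewrite addnACA [RHS]addnACA; congr (_ + _)%N; rewrite addnC.
have nbc : b != c by apply: contraTneq bc => ->; rewrite ltxx.
rewrite delete_neq 1?eq_sym // delete_neq //.
have -> : (\sum_(c0 | (val c0 < val b)%O) #|delete T c y c0|.-1 =
       \sum_(c0 | (val c0 < val b)%O) #|T c0|.-1)%N.
  apply: eq_bigr => e eb; rewrite delete_neq //; apply: contraTneq eb => ->.
  by apply/negP => /(lt_trans bc); rewrite ltxx.
have -> : (\sum_(c0 | (val c0 < val c)%O) #|T c0|.-1 =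
       (\sum_(c0 | (val c0 < val c)%O) #|delete T b x c0|.-1).+1)%N.
  rewrite (bigD1 b) //= [in RHS](bigD1 b) //= delete_eq (cardsD1 x) xT add1n /=.
  have : T b :\ x != set0.
    by move/(face_neq0 b): f2; rewrite delete_neq // delete_eq.
  rewrite -card_gt0; case: #|_| => // k _ /=; rewrite addSn; congr (_ + _).+1.
  by apply: eq_bigr => e /andP[_ eb]; rewrite delete_neq.
by rewrite !addSn signr_S opprK; congr (_ ^+ _); rewrite addnC.
Qed.

Lemma diffK m (s : nerve P m) (w : cochains s) : diff (diff w) = 0.
Proof.
apply/ffunP => F; rewrite !ffunE; set T := val F.
have fT : is_face T := valP F.
transitivity (\sum_b \sum_(x in T b) \sum_c \sum_(y | (y \in T c) && ((c, y) != (b, x)))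
  delete_sign T b x * delete_sign (delete T b x) c y * coef w (delete (delete T b x) c y)).
  apply: eq_bigr => b _; apply: eq_bigr => x xT; rewrite coef_diff.
    rewrite mulr_sumr; apply: eq_bigr => c _; rewrite mulr_sumr; apply: eq_big => y.
      rewrite ffunE xpair_eqE negb_and; case: eqP => [->|_] /=; last by rewrite andbT.
      by rewrite !inE andbC.
    by rewrite mulrA.
  case: (eqVneq (T b :\ x) set0) => h; last by left; rewrite delete_face.
  by right; exists b; rewrite delete_eq.
under eq_bigr => b _ do under eq_bigr => x _ do rewrite pair_big_dep /=.
rewrite pair_big_dep /= (antisym_sum (Q := fun u => u.2 \in T u.1)
  (g := fun u v => delete_sign T u.1 u.2 * delete_sign (delete T u.1 u.2) v.1 v.2
    * coef w (delete (delete T u.1 u.2) v.1 v.2))) // => -[b x] [c y] /= xT yT neq.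
have [f2|nf2] := boolP (is_face (delete (delete T b x) c y)); last first.
  by rewrite [coef _ _]coef_nface // deleteC coef_nface ?mulr0 ?oppr0 // deleteC.
by rewrite delete_sign_anti // mulNr (deleteC T b x).
Qed.

Lemma omap_id_of n (f : 'I_n -> 'I_n) : f =1 id -> omap f =1 id.
Proof. by move=> fid [i|] //=; rewrite fid. Qed.

Lemma omap_over_comp l m n (r : nerve P l) (s : nerve P m) (t : nerve P n)
    (b : over_map s t) (a : over_map r s) x :
  omap (over_comp b a) x = omap b (omap a x).
Proof. by case: x. Qed.

Lemma before_omap m n (a : {omorphism 'I_m.+1 -> 'I_n.+1}) (x y : option 'I_m.+1) :
  before (omap a x) (omap a y) -> before x y.
Proof.
case: x y => [i|] [j|] //=; rewrite !ltnNge; apply: contra => ji.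
exact: (omorph_le a ji).
Qed.

Section Push.
Variables (m n : nat) (s : nerve P m) (t : nerve P n) (a : over_map s t).
Hypothesis top_st : s ord_max = t ord_max.

Implicit Types (T : block_family s).
Local Notation inj_on := (inj_on a).

Lemma inj_onP T : reflect (forall b, {in T b &, injective (omap a)}) (inj_on T).
Proof.
apply: (iffP forallP) => H b; first exact/dinjectiveP.
by apply/dinjectiveP.
Qed.

Fact emb_subproof (b : block s) : val b \in codom t.
Proof. by have /codomP[i ->] := valP b; rewrite -(over_funE a) codom_f. Qed.

Definition emb (b : block s) : block t := SeqSub (emb_subproof b).

Lemma insub_emb b : insub (val (emb b)) = Some b :> option (block s).
Proof. exact: (valK b). Qed.

Lemma push_emb T b : push a T (emb b) = [set omap a x | x in T b].
Proof. by rewrite ffunE insub_emb. Qed.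

Lemma push_out T (c : block t) :
  insub (val c) = None :> option (block s) -> push a T c = [set None].
Proof. by rewrite ffunE => ->. Qed.

Lemma embP (c : block t) b : insub (val c) = Some b :> option (block s) -> emb b = c.
Proof. by case: insubP => // b' _ E [<-]; apply: val_inj. Qed.

Lemma big_emb (V : nmodType) (Q : pred (block t)) (G : block t -> V) :
  (forall c, insub (val c) = None :> option (block s) -> G c = 0) ->
  \sum_(c | Q c) G c = \sum_(b | Q (emb b)) G (emb b).
Proof.
move=> G0; rewrite (bigID (fun c => insub (val c) : option (block s))) /=.
rewrite [X in _ + X]big1 ?addr0; last by move=> c /andP[_]; case E: insub => // _; exact: G0.
rewrite (reindex_omap emb (fun c => insub (val c))) => [|c /andP[_]]; last first.
  by case E: insub => [b|] //= _; rewrite (embP E).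
by apply: eq_bigl => b; rewrite insub_emb eqxx !andbT.
Qed.

Lemma push_face T : is_face T -> is_face (push a T).
Proof.
move=> fT; apply/forallP => c; rewrite ffunE.
case E: insub => [b|]; last first.
  rewrite -card_gt0 cards1; apply/forall_inP => x /set1P -> .
  have : val c != s ord_max; last by rewrite top_st.
  apply/eqP => ec; move: E; rewrite ec insubT ?codom_f //.
have ebc : val c = val b by rewrite -(embP E).
apply/andP; split.
  have /set0Pn[x xT] := face_neq0 b fT.
  by apply/set0Pn; exists (omap a x); apply: imset_f.
apply/forall_inP => _ /imsetP[[i|] xT ->] /=.
  by rewrite over_funE ebc (face_some fT xT).
by rewrite -top_st ebc (face_none fT xT).
Qed.

Lemma push_empty T b : T b = set0 -> push a T (emb b) = set0.
Proof. by move=> E; rewrite push_emb E imset0. Qed.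

Lemma push_card (T : block_family s) b : inj_on T -> #|push a T (emb b)| = #|T b|.
Proof. by move=> /inj_onP aT; rewrite push_emb card_in_imset. Qed.

Lemma push_sum_dim (T : block_family s) (Q : pred (block t)) : inj_on T ->
  (\sum_(c | Q c) #|push a T c|.-1 = \sum_(b | Q (emb b)) #|T b|.-1)%N.
Proof.
move=> aT; rewrite (@big_emb nat) => [|c E]; last by rewrite push_out // cards1.
by apply: eq_bigr => b _; rewrite push_card.
Qed.

Lemma push_delete T b x : inj_on T -> x \in T b ->
  push a (delete T b x) = delete (push a T) (emb b) (omap a x).
Proof.
move=> /inj_onP aT xT; apply/ffunP => c; rewrite [in RHS]ffunE.
case E: (insub (val c) : option (block s)) => [e|]; last first.
  rewrite !push_out //; case: eqP => // cb; move: E.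
  by rewrite cb insub_emb.
rewrite -(embP E) !push_emb ffunE.
have [->|eb] := eqVneq e b; last first.
  by case: eqP => // /(congr1 val)/= /val_inj /eqP; rewrite (negbTE eb).
rewrite eqxx; apply/setP => y; rewrite !inE; apply/imsetP/andP.
  move=> [z]; rewrite !inE => /andP[zx zT] ->; split; last exact: imset_f.
  by apply: contraNneq zx => /(aT b _ _ zT xT) ->.
move=> [yx /imsetP[z zT yz]]; exists z => //; rewrite !inE zT andbT.
by apply: contraNneq yx => <-; rewrite yz.
Qed.

Lemma push_sign T b x : inj_on T -> x \in T b ->
  delete_sign (push a T) (emb b) (omap a x) = delete_sign T b x.
Proof.
move=> aT xT; congr (_ ^+ (_ + _)); first by rewrite push_sum_dim.
rewrite push_emb; move/inj_onP: aT => aT.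
rewrite -[RHS](card_in_imset (f := omap a)); last first.
  by move=> y z; rewrite !inE => /andP[yT _] /andP[zT _]; exact: (aT b).
apply: eq_card => y; rewrite inE; apply/andP/imsetP.
  move=> [/imsetP[z zT ->] zx]; exists z => //.
  by rewrite inE zT (before_omap zx).
move=> [z]; rewrite inE => /andP[zT zx] ->; split; first exact: imset_f.
have : omap a z != omap a x.
  by apply: contraTneq zx => /(aT b _ _ zT xT) ->; rewrite before_irr.
by case/before_total/orP => // /before_omap /before_anti; rewrite zx.
Qed.

Lemma inj_on_delete T b x : inj_on T -> inj_on (delete T b x).
Proof.
move=> /inj_onP aT; apply/inj_onP => c y z; rewrite ffunE.
by case: eqP => [->|_]; [move=> /setD1P[_ yT] /setD1P[_ zT]|move=> yT zT]; exact: aT yT zT.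
Qed.

Lemma coef_restrict w T : is_face T \/ (exists b, T b = set0) ->
  coef (restrict a w) T = if inj_on T then coef w (push a T) else 0.
Proof.
have [fT _|nfT [//|[b Tb]]] := boolP (is_face T).
  by rewrite -[T]/(val (Sub T fT : face s)) coef_face ffunE.
rewrite (coef_empty _ Tb); case: ifP => // _.
by rewrite (coef_empty _ (push_empty Tb)).
Qed.

Lemma face_delete T b x : is_face T ->
  is_face (delete T b x) \/ exists c, delete T b x c = set0.
Proof.
move=> fT; case: (eqVneq (T b :\ x) set0) => h.
  by right; exists b; rewrite delete_eq.
by left; rewrite delete_face.
Qed.

Lemma restrict_diff w : restrict a (diff w) = diff (restrict a w).
Proof.
apply/ffunP => F; rewrite !ffunE; set T := val F.
have fT : is_face T := valP F.
case: ifP => [aT|naT].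
  rewrite coef_diff; last by left; apply: push_face.
  rewrite big_emb; last first.
    move=> c E; rewrite push_out // big_set1 (@coef_empty _ _ _ _ c) ?mulr0 //.
    by rewrite delete_eq push_out // setDv.
  apply: eq_bigr => b _; rewrite push_emb big_imset /=; last first.
    by move/inj_onP: aT => aT; apply: aT.
  apply: eq_bigr => x xT; rewrite push_sign // coef_restrict; last exact: face_delete.
  by rewrite inj_on_delete // push_delete.
have [b [x [y [xT yT xy axy]]]] : exists b x y,
    [/\ x \in T b, y \in T b, before x y & omap a x = omap a y].
  move/negbT: naT; rewrite negb_forall => /existsP[b] /dinjectivePn[x xT [y]].
  rewrite !inE => /andP[yx yT] axy; exists b.
  case/orP: (before_total yx) => h; first by exists y, x.
  by exists x, y.
have xy' : x != y by apply: contraTneq xy => ->; rewrite before_irr.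
have nxy c z : ~~ ((c == b) && ((z == x) || (z == y))) -> inj_on (delete T c z) = false.
  move=> h; apply/negP => /inj_onP/(_ b x y); rewrite !ffunE.
  case: (b =P c) h => [<-|_ _]; last by move/(_ xT yT axy)/eqP; rewrite (negbTE xy').
  rewrite eqxx /= negb_or => /andP[zx zy]; rewrite !inE ![_ == z]eq_sym zx zy xT yT.
  by move/(_ isT isT axy)/eqP; rewrite (negbTE xy').
have pxy : push a (delete T b x) = push a (delete T b y).
  apply/ffunP => c.
  case E: (insub (val c) : option (block s)) => [e|]; last by rewrite !push_out.
  rewrite -(embP E) !push_emb !ffunE; case: eqP => // ->.
  apply/setP => z; apply/imsetP/imsetP => -[u /setD1P[uxy uT] ->].
    have [->|uy] := eqVneq u y; first by exists x; rewrite // !inE xy'.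
    by exists u; rewrite // !inE uy.
  have [->|ux] := eqVneq u x; first by exists y; rewrite // !inE eq_sym xy'.
  by exists u; rewrite // !inE ux.
have ixy : inj_on (delete T b x) = inj_on (delete T b y).
  apply/inj_onP/inj_onP => H c u v; have := H c; rewrite !ffunE; case: (c =P b) => [-> {}H|_ /(_ u v) //].
    rewrite !inE => /andP[uy uT] /andP[vy vT] auv.
    have [ux|ux] := eqVneq u x; have [vx|vx] := eqVneq v x.
    - by rewrite ux vx.
    - have := H y v; rewrite !inE yT vT (eq_sym y x) xy' vx -axy -ux => /(_ isT isT auv) yv.
      by rewrite yv eqxx in vy.
    - have := H u y; rewrite !inE yT uT (eq_sym y x) xy' ux -axy -vx => /(_ isT isT auv) yv.
      by rewrite yv eqxx in uy.
    - by apply: H; rewrite ?inE ?ux ?vx.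
  rewrite !inE => /andP[ux uT] /andP[vx vT] auv.
  have [uy|uy] := eqVneq u y; have [vy|vy] := eqVneq v y.
  - by rewrite uy vy.
  - have := H x v; rewrite !inE xT vT xy' vy axy -uy => /(_ isT isT auv) yv.
    by rewrite yv eqxx in vx.
  - have := H u x; rewrite !inE xT uT xy' uy axy -vy => /(_ isT isT auv) yv.
    by rewrite yv eqxx in ux.
  - by apply: H; rewrite ?inE ?uy ?vy.
rewrite (bigD1 b) //= [X in _ + X]big1 ?addr0; last first.
  move=> c cb; rewrite big1 // => z _; rewrite coef_restrict; last exact: face_delete.
  by rewrite nxy ?mulr0 // (negbTE cb).
rewrite (bigD1 x) //= (bigD1 y) /=; last by rewrite yT eq_sym xy'.
rewrite [X in _ + (_ + X)]big1 ?addr0; last first.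
  move=> z /andP[/andP[_ zx] zy]; rewrite coef_restrict; last exact: face_delete.
  by rewrite nxy ?mulr0 // (negbTE zx) (negbTE zy) andbF.
rewrite !coef_restrict; [|exact: face_delete..].
rewrite ixy pxy; case: ifP => [iT|_]; last by rewrite !mulr0 addr0.
rewrite -mulrDl /delete_sign !exprD (card_before_D1 xT xy) signr_S.
suff -> : [set z in T b :\ x | before z y] = [set z in T b | before z x].
  by rewrite mulrN addrN mul0r.
apply/setP => z; rewrite !inE.
have [->|zx] := eqVneq z x; first by rewrite before_irr andbF.
case zT: (z \in T b) => //=; case zy: (before z y); last first.
  by symmetry; apply: contraFF zy => zx'; apply: before_trans xy.
symmetry; case/orP: (before_total zx) => // xz.
have : omap a z = omap a x.
  have [//|] := eqVneq (omap a z) (omap a x).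
  case/before_total/orP => [/before_omap/before_anti|]; first by rewrite xz.
  by rewrite axy => /before_omap/before_anti; rewrite zy.
have zy' : z != y by apply: contraTneq zy => ->; rewrite before_irr.
move=> azx; move/inj_onP: iT => /(_ b z x); rewrite delete_eq !inE zT xT zy' xy'.
by move=> /(_ isT isT azx) E; rewrite E eqxx in zx.
Qed.

Lemma perverse_degree_push T x : is_face T -> inj_on T ->
  perverse_degree_face (push a T) x = perverse_degree_face T x \/
  perverse_degree_face T x = -oo%E.
Proof.
move=> fT aT; rewrite /perverse_degree_face top_st.
case: (x == t ord_max); first by left.
case E: (insub x : option (block s)) => [b|]; last by right.
case: ifP => nb; last by right.
left; have -> : insub x = Some (emb b) :> option (block t).
  have -> : x = val (emb b) by case: insubP E => // b' _ <- [<-].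
  exact: valK.
rewrite push_emb; have -> : None \notin [set omap a x0 | x0 in T b].
  by apply: contra nb => /imsetP[[i|] xT].
by rewrite (push_sum_dim (fun c => (val (emb b) < val c)%O)).
Qed.

End Push.

Lemma allowableP (p : perversity) m (s : nerve P m) (w : cochains s) :
  allowable p w <->
  forall F : face s, w F != 0 -> forall x, (perverse_degree_face (val F) x <= p x)%E.
Proof.
split=> [H F wF x|H x].
  by have /bigmax_leP[_ ] := H x; apply.
by apply/bigmax_leP; split => [|F wF]; [exact: leNye|exact: H].
Qed.

Lemma restrict_allowable (p : perversity) m n (s : nerve P m) (t : nerve P n)
    (a : over_map s t) (w : cochains t) :
  s ord_max = t ord_max -> allowable p w -> allowable p (restrict a w).
Proof.
move=> st /allowableP H; apply/allowableP => F; rewrite ffunE.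
case: ifP => [aF|_]; last by rewrite eqxx.
have fF : is_face (push a (val F)) by apply: push_face (valP F).
rewrite -[push a (val F)]/(val (Sub _ fF : face t)) coef_face => wF x.
case: (perverse_degree_push st x (valP F) aF) => [<-|->]; last exact: leNye.
exact: (H _ wF).
Qed.

Lemma restrict_homogeneous k m n (s : nerve P m) (t : nerve P n)
    (a : over_map s t) (w : cochains t) :
  s ord_max = t ord_max -> homogeneous k w -> homogeneous k (restrict a w).
Proof.
move=> st H F; rewrite ffunE.
case: ifP => [aF|_]; last by rewrite eqxx.
have fF : is_face (push a (val F)) by apply: push_face (valP F).
rewrite -[push a (val F)]/(val (Sub _ fF : face t)) coef_face => /H <-.
by rewrite /face_dim /= push_sum_dim.
Qed.

Lemma restrict1 m (s : nerve P m) (a : over_map s s) (w : cochains s) :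
  a =1 id -> restrict a w = w.
Proof.
move=> aid; apply/ffunP => F; rewrite ffunE.
have aF : inj_on a (val F).
  by apply/inj_onP => b x y _ _; rewrite !omap_id_of.
rewrite aF -coef_face; congr coef; apply/ffunP => b.
rewrite ffunE valK; apply/setP => x; apply/imsetP/idP => [[y yF ->]|xF].
  by rewrite omap_id_of.
by exists x; rewrite ?omap_id_of.
Qed.

Lemma restrictM l m n (r : nerve P l) (s : nerve P m) (t : nerve P n)
    (b : over_map s t) (a : over_map r s) (w : cochains t) :
  r ord_max = s ord_max ->
  restrict (over_comp b a) w = restrict a (restrict b w).
Proof.
move=> rs; apply/ffunP => F; rewrite [LHS]ffunE [RHS]ffunE.
set T := val F; have fT : is_face T := valP F.
have pE : push (over_comp b a) T = push b (push a T).
  apply/ffunP => c; rewrite !ffunE.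
  case E: (insub (val c) : option (block r)) => [e|].
    have -> : insub (val c) = Some (emb a e) :> option (block s).
      have -> : val c = val (emb a e) by case: insubP E => // b' _ <- [<-].
      exact: valK.
    rewrite push_emb -imset_comp; apply: eq_imset => x; exact: omap_over_comp.
  case E': (insub (val c) : option (block s)) => [e|//].
  rewrite push_out ?imset_set1 //; move: E.
  by have -> : val c = val e by case: insubP E' => // b' _ <- [<-].
have iE : inj_on (over_comp b a) T = inj_on a T && inj_on b (push a T).
  apply/inj_onP/andP => [H|[/inj_onP Ha /inj_onP Hb] c x y xT yT].
    split; apply/inj_onP => c x y.
      by move=> xT yT axy; apply: (H c x y xT yT); rewrite !omap_over_comp axy.
    case E: (insub (val c) : option (block r)) => [e|]; last first.
      by rewrite !push_out // => /set1P -> /set1P ->.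
    rewrite -(embP a E) !push_emb => /imsetP[x' xT ->] /imsetP[y' yT ->].
    by rewrite -!omap_over_comp => /(H e x' y' xT yT) ->.
  rewrite !omap_over_comp => bxy; apply: (Ha c x y xT yT).
  by apply: (Hb (emb a c)) bxy; rewrite push_emb; apply: imset_f.
rewrite iE pE; case: (inj_on a T) => //=.
by rewrite coef_restrict //; left; apply: push_face.
Qed.

Lemma regular_top m n (s : nerve P m) (t : nerve P n) (a : over_map s t) :
  regular s -> s ord_max = t ord_max.
Proof.
move=> rs; symmetry; apply: rs; rewrite -(over_funE a).
by apply: omorph_le; apply: leq_ord.
Qed.

Lemma regular_over m n (s : nerve P m) (t : nerve P n) (a : over_map s t) :
  regular s -> regular t.
Proof. by move=> rs; rewrite /regular -(regular_top a rs). Qed.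

End BlownUp.

Arguments perversity {d} P.

Section Functors.
Context {d : Order.disp_t} {P : porderType d}.
Variables (R : comPzRingType) (p : perversity P).

Section Simplex.
Variables (m : nat) (s : nerve P m).

Lemma blowup_closed k : submod_closed (blowup_pred (R := R) p (s := s) k).
Proof.
split; rewrite ?/blowup_pred.
  rewrite unfold_in; case: ifP => // _; apply/asboolP; split.
  - by move=> F; rewrite ffunE eqxx.
  - by apply/allowableP => F; rewrite ffunE eqxx.
  - by rewrite linear0; apply/allowableP => F; rewrite ffunE eqxx.
move=> c w v; rewrite !unfold_in; case: ifP => _; last first.
  by move=> /eqP -> /eqP ->; rewrite scaler0 addr0.
have lin (u u' : cochains R s) F : (c *: u + u') F != 0 -> u F != 0 \/ u' F != 0.
  rewrite !ffunE; case: (eqVneq (u F) 0) => [-> |]; last by left.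
  by rewrite scaler0 add0r; right.
have lin_allow (u u' : cochains R s) :
    allowable p u -> allowable p u' -> allowable p (c *: u + u').
  move=> /allowableP Hu /allowableP Hu'; apply/allowableP => F /lin[] h x.
    exact: Hu.
  exact: Hu'.
move=> /asboolP[wk wp dwp] /asboolP[vk vp dvp]; apply/asboolP; split.
- by move=> F /lin[]; [exact: wk|exact: vk].
- exact: lin_allow.
- by rewrite linearP; exact: lin_allow.
Qed.

HB.instance Definition _ k :=
  GRing.isSubmodClosed.Build R (cochains R s) (blowup_pred p k) (blowup_closed k).

Record blowup_simplex k := BlowupSimplex {
  blowup_val :> cochains R s;
  blowup_valP : blowup_val \in blowup_pred p k }.

HB.instance Definition _ k := [isSub for @blowup_val k].
HB.instance Definition _ k := [Choice of blowup_simplex k by <:].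
HB.instance Definition _ k := [SubChoice_isSubLmodule of blowup_simplex k by <:].

Lemma diff_homogeneous k (w : cochains R s) :
  homogeneous k w -> homogeneous k.+1 (diff w).
Proof.
move=> wk F; have fF := valP F; set T := val F in fF *.
rewrite -coef_face coef_diff; last by left.
apply: contraNeq => dk; apply/eqP; rewrite big1 // => b _; rewrite big1 // => x xT.
have [fT|nfT] := boolP (is_face (delete T b x)); last by rewrite coef_nface ?mulr0.
suff -> : coef w (delete T b x) = 0 by rewrite mulr0.
apply/eqP; apply: contraNT dk.
rewrite -[delete T b x]/(val (Sub _ fT : face s)) coef_face => /wk /= <-.
rewrite /face_dim (bigD1 b) //= [in X in _ == X.+1](bigD1 b) //= delete_eq.
have : T b :\ x != set0 by rewrite -delete_face.
rewrite (cardsD1 x (T b)) xT add1n /= -card_gt0; case: #|_| => // j _ /=.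
rewrite addSn eqSS eqn_add2l; apply/eqP; apply: eq_bigr => c cb.
by rewrite delete_neq.
Qed.

Lemma blowup_diff_subproof k (w : blowup_simplex k) :
  diff (w : cochains R s) \in blowup_pred p k.+1.
Proof.
have := blowup_valP w; rewrite !unfold_in; case: ifP => _.
  move=> /asboolP[wk wp dwp]; apply/asboolP; split=> //.
    exact: diff_homogeneous.
  by rewrite diffK; apply/allowableP => F; rewrite ffunE eqxx.
by move=> /eqP ->; rewrite linear0.
Qed.

Definition blowup_diff k (w : blowup_simplex k) : blowup_simplex k.+1 :=
  BlowupSimplex (blowup_diff_subproof w).

Lemma blowup_diff_is_linear k : linear (@blowup_diff k).
Proof. by move=> c w v; apply: val_inj; rewrite /= linearP. Qed.

HB.instance Definition _ k :=
  GRing.isLinear.Build R (blowup_simplex k) (blowup_simplex k.+1) _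
    (@blowup_diff k) (@blowup_diff_is_linear k).

Lemma blowup_diffK k (w : blowup_simplex k) : blowup_diff (blowup_diff w) = 0.
Proof. by apply: val_inj; rewrite /= diffK. Qed.

Definition blowup_complex : cochain_complex R :=
  @CochainComplex R (fun k => blowup_simplex k) (fun k => @blowup_diff k) blowup_diffK.

End Simplex.

Section Restriction.
Variables (m n : nat) (s : nerve P m) (t : nerve P n) (a : over_map s t).

(* The complex of a non-regular simplex is 0; if s is regular, so is t. *)
Definition restrict_reg (w : cochains R t) : cochains R s :=
  if `[< regular s >] then restrict a w else 0.

Lemma restrict_reg_is_linear : linear restrict_reg.
Proof.
move=> c w v; rewrite /restrict_reg; case: ifP => _; first by rewrite linearP.
by rewrite scaler0 addr0.
Qed.

HB.instance Definition _ :=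
  GRing.isLinear.Build R (cochains R t) (cochains R s) _ restrict_reg
    restrict_reg_is_linear.

Lemma blowup_res_subproof k (w : blowup_simplex t k) :
  restrict_reg w \in blowup_pred p k.
Proof.
have := blowup_valP w; rewrite !unfold_in /restrict_reg.
case: (asboolP (regular s)) => [rs|_ _]; last exact: eqxx.
rewrite asboolT; last exact: regular_over rs.
have st := regular_top a rs.
move=> /asboolP[wk wp dwp]; apply/asboolP; split.
- exact: restrict_homogeneous.
- exact: restrict_allowable.
- by rewrite -restrict_diff //; apply: restrict_allowable.
Qed.

Definition blowup_res k (w : blowup_simplex t k) : blowup_simplex s k :=
  BlowupSimplex (blowup_res_subproof w).

Lemma blowup_res_is_linear k : linear (@blowup_res k).
Proof. by move=> c w v; apply: val_inj; rewrite /= linearP. Qed.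

HB.instance Definition _ k :=
  GRing.isLinear.Build R (blowup_simplex t k) (blowup_simplex s k) _
    (@blowup_res k) (@blowup_res_is_linear k).

Lemma blowup_res_diff k (w : blowup_simplex t k) :
  blowup_res (blowup_diff w) = blowup_diff (blowup_res w).
Proof.
apply: val_inj; rewrite /= /restrict_reg; case: asboolP => [rs|_].
  by rewrite restrict_diff //; apply: regular_top rs.
by rewrite linear0.
Qed.

Definition blowup_res_map : cochain_map (blowup_complex t) (blowup_complex s) :=
  @CochainMap R (blowup_complex t) (blowup_complex s) (fun k => @blowup_res k)
    blowup_res_diff.

End Restriction.

Lemma blowup_res1 m (s : nerve P m) k (w : blowup_simplex s k) :
  blowup_res (over_id s) w = w.
Proof.
apply: val_inj; rewrite /= /restrict_reg.
have := blowup_valP w; rewrite unfold_in; case: ifP => _; last by move/eqP.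
by move=> _; apply: restrict1.
Qed.

Lemma blowup_resM l m n (r : nerve P l) (s : nerve P m) (t : nerve P n)
    (b : over_map s t) (a : over_map r s) k (w : blowup_simplex t k) :
  blowup_res (over_comp b a) w = blowup_res a (blowup_res b w).
Proof.
apply: val_inj; rewrite /= /restrict_reg; case: asboolP => // rr.
rewrite asboolT; last exact: regular_over rr.
by rewrite restrictM //; apply: regular_top rr.
Qed.

Definition blowup_presheaf k : mod_presheaf R :=
  @ModPresheaf d P R (fun m s => blowup_simplex s k)
    (fun m n s t a => @blowup_res m n s t a k)
    (fun m s w => blowup_res1 w)
    (fun l m n r s t b a w => blowup_resM b a w).

Definition blowup_presheaf_diff k :
    presheaf_map (psh_of_mpsh (blowup_presheaf k)) (psh_of_mpsh (blowup_presheaf k.+1)) :=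
  @PresheafMap d P (psh_of_mpsh (blowup_presheaf k)) (psh_of_mpsh (blowup_presheaf k.+1))
    (fun m s w => blowup_diff w)
    (fun m n s t a w => esym (blowup_res_diff a w)).

Section Global.
Variable L : SsetP P.

Definition global k : Type := sections L (blowup_presheaf k).
HB.instance Definition _ k := GRing.Lmodule.on (global k).

Definition global_diff k (h : global k) : global k.+1 :=
  cmp (total_map (blowup_presheaf_diff k) : mor (c := SsetP P) _ _) h.

Lemma sec_val_diff k (h : global k) n (x : L n) :
  sec_val (global_diff h) x = blowup_diff (sec_val h x).
Proof.
apply: (existT_value (F := psh_of_mpsh (blowup_presheaf k.+1))).
rewrite -[LHS](valueE (F := psh_of_mpsh (blowup_presheaf k.+1))) /=.
by rewrite (valueE (F := psh_of_mpsh (blowup_presheaf k))).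
Qed.

Lemma global_diff_is_linear k : linear (@global_diff k).
Proof.
by move=> c h g; apply: sec_val_eq => n x; rewrite !(sec_val_diff, sec_valP) linearP.
Qed.

HB.instance Definition _ k :=
  GRing.isLinear.Build R (global k) (global k.+1) _ (@global_diff k)
    (@global_diff_is_linear k).

Lemma global_diffK k (h : global k) : global_diff (global_diff h) = 0.
Proof.
apply: sec_val_eq => n x; rewrite !sec_val_diff blowup_diffK.
by rewrite [RHS]sec_val0.
Qed.

Definition global_complex : Mdg R :=
  @CochainComplex R (fun k => global k) (fun k => @global_diff k) global_diffK.

End Global.

Section GlobalMap.
Variables (K L : SsetP P) (f : mor K L).

Definition global_pull k (h : global L k) : global K k := cmp (c := SsetP P) h f.

Lemma sec_val_pull k (h : global L k) n (x : K n) :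
  sec_val (global_pull h) x =
  mpsh_res (blowup_presheaf k) (over_eq (esym (smap_totE f x))) (sec_val h (f n x)).
Proof.
apply: etrans (psh_resM (p := psh_of_mpsh (blowup_presheaf k)) _ _ _).
exact: (psh_res_ext (F := psh_of_mpsh (blowup_presheaf k))).
Qed.

Lemma global_pull_is_linear k : linear (@global_pull k).
Proof.
by move=> c h g; apply: sec_val_eq => n x; rewrite !(sec_val_pull, sec_valP) linearP.
Qed.

HB.instance Definition _ k :=
  GRing.isLinear.Build R (global L k) (global K k) _ (@global_pull k)
    (@global_pull_is_linear k).

Lemma global_pull_diff k (h : global L k) :
  global_pull (global_diff h) = global_diff (global_pull h).
Proof. by rewrite /global_pull /global_diff cmpA. Qed.

Definition global_map : mor (global_complex L) (global_complex K) :=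
  @CochainMap R (global_complex L) (global_complex K) (fun k => @global_pull k)
    global_pull_diff.

End GlobalMap.

(* \tilde N^*_p(-). *)
Definition blowup : contravariant (SsetP P) (Mdg R).
Proof.
refine (@Contravariant _ _ global_complex global_map _ _).
- by move=> L; apply: cochain_map_eq => k h; apply: smap_over_eq.
- by move=> K L J g f; apply: cochain_map_eq => k h; apply: smap_over_eq.
Defined.

Lemma angle_res1 (M : Mdg R) m (s : nerve P m)
    (f : cochain_map M (blowup_complex s)) :
  cochain_comp (blowup_res_map (over_id s)) f = f.
Proof. by apply: cochain_map_eq => k x; apply: blowup_res1. Qed.

Lemma angle_resM (M : Mdg R) l m n (r : nerve P l) (s : nerve P m) (t : nerve P n)
    (b : over_map s t) (a : over_map r s) (f : cochain_map M (blowup_complex t)) :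
  cochain_comp (blowup_res_map (over_comp b a)) f =
  cochain_comp (blowup_res_map a) (cochain_comp (blowup_res_map b) f).
Proof. by apply: cochain_map_eq => k x; apply: blowup_resM. Qed.

Definition angle_presheaf (M : Mdg R) : presheaf P :=
  @Presheaf d P (fun m s => mor M (blowup_complex s : Mdg R))
    (fun m n s t a f => cochain_comp (blowup_res_map a) f)
    (fun m s f => angle_res1 f) (fun l m n r s t b a f => angle_resM b a f).

Definition angle_presheaf_map (M N : Mdg R) (f : mor M N) :
    presheaf_map (angle_presheaf N) (angle_presheaf M) :=
  @PresheafMap d P (angle_presheaf N) (angle_presheaf M)
    (fun m s g => cmp (g : mor N (blowup_complex s : Mdg R)) f)
    (fun m n s t a g => esym (cmpA (blowup_res_map a : mor (c := Mdg R) _ _) g f)).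

(* <->_p. *)
Definition angle : contravariant (Mdg R) (SsetP P).
Proof.
refine (@Contravariant (Mdg R) (SsetP P) (fun M => total_space (angle_presheaf M))
  (fun M N f => total_map (angle_presheaf_map f)) _ _).
- move=> M; apply: smap_over_eq => n [s g]; congr existT; exact: (cmpf1 (c := Mdg R)).
- move=> M N K g f; apply: smap_over_eq => n [s h]; congr existT.
  exact: (cmpA (c := Mdg R)).
Defined.

End Functors.

(* Main.v *)
(** Elements of either side amount to families of cochains [w x k z] of degree [k] on
    the simplices [Psi_L x], for [x] a simplex of [L] and [z] in [M k], that are linear
    in [z] and compatible with the differentials and the simplicial operators; the
    bijection exchanges the order of the arguments [x] and [(k, z)]. *)

Require Import Defs.
From HB Require Import structures.
From mathcomp Require Import all_boot all_order all_algebra.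

Set Implicit Arguments.
Unset Strict Implicit.
Unset Printing Implicit Defensive.

Import GRing.Theory.
Local Open Scope ring_scope.

Section Values.
Context {d : Order.disp_t} {P : porderType d}.

(** The two values lie over simplices of the nerve that are only provably equal, hence the
    transport. Both sides restrict the same component of [h n (g n x)] along maps with underlying
    identity, so functoriality identifies them. *)
Lemma value_comp (F : presheaf P) (K L : sset_over P)
    (h : smap_over L (total_space F)) (g : smap_over K L) n (x : K n) :
  value (smap_over_comp h g) x =
  psh_res (over_eq (esym (smap_totE g x))) (value h (g n x)).
Proof. by rewrite -psh_resM; apply: psh_res_ext. Qed.

(** Naturality of [u] moves it past the transport hidden in [value]. *)
Lemma value_total_map (F G : presheaf P) (u : presheaf_map F G) (L : sset_over P)
    (h : smap_over L (total_space F)) n (x : L n) :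
  value (smap_over_comp (total_map u) h) x = u n _ (value h x).
Proof. by rewrite [RHS]psh_mapE; apply: psh_res_ext. Qed.

End Values.

Section Adjunction.
Context {d : Order.disp_t} {P : porderType d}.
Variables (R : comPzRingType) (p : perversity P) (L : SsetP P) (M : Mdg R).

Section Transpose.
Variable h : mor L (angle R p M).

Definition angle_val n (x : L n) : cochain_map M (blowup_complex R p (sset_proj L n x)) :=
  value (F := angle_presheaf p M) h x.

(** Restriction in [angle_presheaf] is postcomposition with [blowup_res_map]; evaluated at [z] it
    becomes restriction of cochains. This is what lets the values at a fixed [z] be assembled into a
    section. *)
Lemma angle_val_act m n (a : {omorphism 'I_m.+1 -> 'I_n.+1}) (x : L n) k (z : M k) :
  angle_val (sact a x) k z =
  mpsh_res (blowup_presheaf R p k) (over_proj a x) (angle_val x k z).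
Proof. by rewrite /angle_val (value_act (F := angle_presheaf p M)). Qed.

Definition transpose_fun k (z : M k) : global R p L k :=
  of_values (F := psh_of_mpsh (blowup_presheaf R p k))
    (fun m n a x => angle_val_act a x z).

Lemma sec_val_transpose k (z : M k) n (x : L n) :
  sec_val (transpose_fun z) x = angle_val x k z.
Proof. exact: (of_valuesE (F := psh_of_mpsh (blowup_presheaf R p k))). Qed.

Lemma transpose_is_linear k : linear (@transpose_fun k).
Proof.
move=> c z y; apply: sec_val_eq => n x.
by rewrite sec_valP !sec_val_transpose linearP.
Qed.

HB.instance Definition _ k :=
  GRing.isLinear.Build R (M k) (global R p L k) _ (@transpose_fun k)
    (@transpose_is_linear k).

Lemma transpose_diff k (z : M k) :
  transpose_fun (cx_diff M k z) = global_diff (transpose_fun z).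
Proof.
apply: sec_val_eq => n x.
by rewrite sec_val_diff !sec_val_transpose cx_mapE.
Qed.

Definition transpose : mor M (blowup R p L) :=
  @CochainMap R M (blowup R p L) (fun k => @transpose_fun k) transpose_diff.

End Transpose.

Section Untranspose.
Variable f : mor M (blowup R p L).

Section Simplex.
Variables (n : nat) (x : L n).

Definition untranspose_val k (z : M k) : blowup_simplex R p (sset_proj L n x) k :=
  sec_val (F := blowup_presheaf R p k) ((f : cochain_map _ _) k z) x.

Lemma untranspose_val_is_linear k : linear (@untranspose_val k).
Proof. by move=> c z y; rewrite /untranspose_val linearP [LHS]sec_valP. Qed.

HB.instance Definition _ k :=
  GRing.isLinear.Build R (M k) (blowup_simplex R p (sset_proj L n x) k) _
    (@untranspose_val k) (@untranspose_val_is_linear k).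

Lemma untranspose_val_diff k (z : M k) :
  untranspose_val (cx_diff M k z) = blowup_diff (untranspose_val z).
Proof. by rewrite /untranspose_val cx_mapE [LHS]sec_val_diff. Qed.

Definition untranspose_map : cochain_map M (blowup_complex R p (sset_proj L n x)) :=
  @CochainMap R M (blowup_complex R p (sset_proj L n x)) (fun k => @untranspose_val k)
    untranspose_val_diff.

End Simplex.

(** Cochain maps are compared at each [z], where the claim is the compatibility of the section
    [f k z] with [a]. *)
Lemma untranspose_map_act m n (a : {omorphism 'I_m.+1 -> 'I_n.+1}) (x : L n) :
  untranspose_map (sact a x) =
  psh_res (p := angle_presheaf p M) (over_proj a x) (untranspose_map x).
Proof.
by apply: cochain_map_eq => k z; apply: (sec_val_act (F := blowup_presheaf R p k)).
Qed.

Definition untranspose : mor L (angle R p M) :=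
  of_values (F := angle_presheaf p M) untranspose_map_act.

Lemma angle_val_untranspose n (x : L n) : angle_val untranspose x = untranspose_map x.
Proof. exact: (of_valuesE (F := angle_presheaf p M)). Qed.

End Untranspose.

Lemma transposeK : cancel transpose untranspose.
Proof.
move=> h; apply: (value_eq (F := angle_presheaf p M)) => n x.
apply: etrans (angle_val_untranspose _ x) _.
by apply: cochain_map_eq => k z; apply: sec_val_transpose.
Qed.

Lemma untransposeK : cancel untranspose transpose.
Proof.
move=> f; apply: cochain_map_eq => k z; apply: sec_val_eq => n x.
by rewrite [LHS]sec_val_transpose angle_val_untranspose.
Qed.

End Adjunction.

Theorem proposition4p1 (R : comPzRingType) (d : Order.disp_t) (P : porderType d)
    (p : perversity P) :
  exists phi : forall (L : SsetP P) (M : Mdg R),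
      mor L (angle R p M) -> mor M (blowup R p L),
    [/\ forall (L : SsetP P) (M : Mdg R), bijective (phi L M),
        forall (K L : SsetP P) (M : Mdg R) (g : mor K L) (h : mor L (angle R p M)),
          phi K M (cmp h g) = cmp (fmap (blowup R p) g) (phi L M h)
      & forall (L : SsetP P) (M N : Mdg R) (f : mor N M) (h : mor L (angle R p M)),
          phi L N (cmp (fmap (angle R p) f) h) = cmp (phi L M h) f].
Proof.
exists (fun L M => @transpose d P R p L M); split.
- by move=> L M; exists (@untranspose d P R p L M);
    [exact: transposeK|exact: untransposeK].
(* Naturality in [L]: at [z] and [x], both sides are the value of [h] at [g n x], evaluated at [z]
   and transported to the simplex below [x]. *)
- move=> K L M g h; apply: cochain_map_eq => k z; apply: sec_val_eq => n x.
  rewrite [LHS]sec_val_transpose [RHS]sec_val_pull [in RHS]sec_val_transpose.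
  by rewrite /angle_val [X in cx_map X](value_comp (F := angle_presheaf p M)).
(* Naturality in [M]: both sides evaluate the cochain map [angle_val h x] at [f k z], since [angle]
   acts on [f] by precomposition in each fibre. *)
- move=> L M N f h; apply: cochain_map_eq => k z; apply: sec_val_eq => n x.
  rewrite [LHS]sec_val_transpose [RHS]sec_val_transpose /angle_val.
  by rewrite [X in cx_map X](value_total_map (angle_presheaf_map p f)).
Qed.
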